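(* For any integer $r\ge 3$, there are infinitely many $r$-connected, $r$-regular graphs $G$ of class 1 with $\mathcal{N}^*(G)\ne\emptyset$.
   Context: A graph is of class 1 if its edge chromatic number equals its maximum degree. For a matching-covered graph $G$ (connected, every edge in some perfect matching; every regular class 1 graph is such), an edge set $X\subseteq E(G)$ is feasible if there are perfect matchings $M_1,M_2$ of $G$ with $|M_1\cap X|\not\equiv|M_2\cap X|\pmod 2$, non-feasible otherwise. $\nabla_G(V_0)$ is the set of edges with exactly one end in $V_0$; $X\sim_G Y$ means $X=Y\oplus\nabla_G(V_0)$ for some $V_0\subseteq V(G)$. $\mathcal{N}^*(G)$ is the set of non-feasible $X\subseteq E(G)$ with neither $X\sim_G\emptyset$ nor $X\sim_G E(G)$. *)

(* Defs.v *)
From mathcomp Require Import all_boot.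

Set Implicit Arguments.
Unset Strict Implicit.
Unset Printing Implicit Defensive.

(* Finite simple graphs.  Multigraphs would add nothing here: an r-regular
   multigraph that is r-connected (with more than r vertices) is simple, since
   the neighbours of a vertex incident with parallel edges would form a
   separator with fewer than r vertices. *)
Record sgraph := SGraph {
  vertex :> finType;
  adj : rel vertex;
  adj_sym : symmetric adj;
  adj_irrefl : irreflexive adj }.

Definition isomorphic (G H : sgraph) : Prop :=
  exists2 f : G -> H, bijective f & forall x y, adj (f x) (f y) = adj x y.

Section Graph.
Variable G : sgraph.
Implicit Types (x y v : G) (W S : {set G}) (e : {set G}).
Implicit Types (M X Y : {set {set G}}) (k r : nat).

(* An edge is the set of its two ends. *)
Definition edges : {set {set G}} :=
  [set [set p.1; p.2] | p in [set p : G * G | adj p.1 p.2]].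

Definition degree v : nat := #|[set w | adj v w]|.

Definition max_degree : nat := \max_(v : G) degree v.

Definition regular r : bool := [forall v, degree v == r].

Definition connected_on (A : {set G}) : bool :=
  [forall x in A, forall y in A,
     connect [rel u v | [&& u \in A, v \in A & adj u v]] x y].

Definition k_connected k : bool :=
  (k < #|G|) && [forall S : {set G}, (#|S| < k) ==> connected_on (~: S)].

Definition edge_type : finType := {e : {set G} | e \in edges}.

Definition proper_edge_colouring k (c : {ffun edge_type -> 'I_k}) : bool :=
  [forall e : edge_type, forall f : edge_type,
     (e != f) && ~~ [disjoint val e & val f] ==> (c e != c f)].

Definition edge_colourable k : bool :=
  [exists c : {ffun edge_type -> 'I_k}, proper_edge_colouring c].

Lemma edge_colourable_exists : exists k, edge_colourable k.
Proof.
exists #|edge_type|; apply/existsP; exists [ffun e => enum_rank e].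
apply/forallP=> e; apply/forallP=> f; apply/implyP=> /andP[ef _].
by rewrite !ffunE (inj_eq enum_rank_inj).
Qed.

Definition edge_chromatic_number : nat := ex_minn edge_colourable_exists.

Definition class1 : bool := edge_chromatic_number == max_degree.

Definition perfect_matching M : bool :=
  [&& M \subset edges, trivIset M & cover M == [set: G]].

Definition feasible X : bool :=
  [exists M1 : {set {set G}}, exists M2 : {set {set G}},
     [&& perfect_matching M1, perfect_matching M2
       & #|M1 :&: X| != #|M2 :&: X| %[mod 2]]].

Definition nabla W : {set {set G}} :=
  [set e in edges | #|e :&: W| == 1].

Definition symdiff X Y : {set {set G}} := (X :\: Y) :|: (Y :\: X).

Definition cut_equiv X Y : bool :=
  [exists W : {set G}, X == symdiff Y (nabla W)].

Definition Nstar : {set {set {set G}}} :=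
  [set X : {set {set G}} | [&& X \subset edges, ~~ feasible X,
     ~~ cut_equiv X set0 & ~~ cut_equiv X edges]].

End Graph.

(* Main.v *)
Require Import Defs.
From mathcomp Require Import all_boot.
From mathcomp Require Import ssralg finalg zmodp.

Set Implicit Arguments.
Unset Strict Implicit.
Unset Printing Implicit Defensive.

Import GRing.Theory.

(** Let F be an r-regular, r-connected, r-edge-coloured graph of even order
  with a vertex u, and replace each vertex on one side of K_{r,r} by a copy of
  F - u, whose r dangling edges become the r edges at the replaced vertex.  The
  result is again r-regular, r-connected and r-edge-coloured.  The copies are r
  odd components left by deleting the other side, which has r vertices, so a
  perfect matching leaves each copy through exactly one edge and has
  (|F| - 2) / 2 edges inside it.  Hence the set X of edges inside one copy is
  not feasible.  If F - u has a triangle, then X is not a cut because of the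
  triangle in that copy, and its complement is not a cut because of the
  triangles in the other copies.  Iterating from the prism over K_r gives
  infinitely many graphs. *)

Lemma connect_homo (T T' : finType) (e : rel T) (e' : rel T') (h : T -> T') :
  (forall x y, e x y -> connect e' (h x) (h y)) ->
  forall x y, connect e x y -> connect e' (h x) (h y).
Proof.
move=> he x y /connectP[p + ->]; elim: p x => [|z p IHp] x //= /andP[xz pP].
exact: connect_trans (he _ _ xz) (IHp _ pP).
Qed.

Lemma exists_notin (T : finType) (A : {set T}) :
  #|A| < #|T| -> exists x, x \notin A.
Proof.
move=> ltA; apply/existsP; rewrite -negb_forall; apply: contraL ltA => /forallP allA.
rewrite -leqNgt; apply/subset_leq_card/subsetP=> x _; exact: allA.
Qed.

Lemma card_setI_sum (T : finType) (A W : {set T}) :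
  #|A :&: W| = \sum_(z in A) (z \in W : nat).
Proof.
rewrite -sum1_card (eq_bigl (fun z => (z \in A) && (z \in W))).
  by rewrite big_mkcondr; apply: eq_bigr => z _; case: (z \in W).
by move=> z; rewrite inE.
Qed.

Lemma sum_eqb (I : finType) (i : I) : \sum_j (i == j : nat) = 1.
Proof.
by rewrite (bigD1 i) //= eqxx big1 // => j /negPf; rewrite eq_sym => ->.
Qed.

(** * Graphs and their one-factorisations *)

Section Graphs.
Variable G : sgraph.
Implicit Types (x y z : G) (W S : {set G}) (M : {set {set G}}).

Definition avoiding S : rel G :=
  [rel x y | [&& x \in ~: S, y \in ~: S & adj x y]].

Lemma avoiding_sym S : connect_sym (avoiding S).
Proof.
by apply: sym_connect_sym => x y; rewrite /avoiding /= adj_sym andbCA.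
Qed.

Lemma connected_onCP S :
  reflect (forall x y, x \notin S -> y \notin S -> connect (avoiding S) x y)
          (connected_on (~: S)).
Proof.
apply: (iffP forall_inP) => [h x y xS yS|h x].
  have /forall_inP : [forall y in ~: S, connect (avoiding S) x y].
    by apply: h; rewrite inE.
  by apply; rewrite inE.
by rewrite inE => xS; apply/forall_inP=> y; rewrite inE => yS; apply: h.
Qed.

Lemma k_connectedCP k :
  reflect (k < #|G| /\ forall S : {set G}, #|S| < k ->
             forall x y, x \notin S -> y \notin S -> connect (avoiding S) x y)
          (k_connected G k).
Proof.
apply: (iffP andP) => -[kG h]; split=> //.
  by move=> S Sk; apply/connected_onCP; move/forallP/(_ S)/implyP: h; apply.
by apply/forallP=> S; apply/implyP=> Sk; apply/connected_onCP/h.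
Qed.

Lemma adj_neq x y : adj x y -> x != y.
Proof. by apply: contraTneq => ->; rewrite adj_irrefl. Qed.

Lemma edgeP (e : {set G}) :
  reflect (exists x y, adj x y /\ e = [set x; y]) (e \in edges G).
Proof.
apply: (iffP imsetP) => [[[x y]]|[x [y [xy ->]]]].
  by rewrite inE => /= xy ->; exists x, y.
by exists (x, y); rewrite ?inE.
Qed.

Lemma edge_adj x y : adj x y -> [set x; y] \in edges G.
Proof. by move=> xy; apply/edgeP; exists x, y. Qed.

Lemma sum_mem_pair x y W :
  x != y -> \sum_(z in [set x; y]) (z \in W : nat) = (x \in W) + (y \in W).
Proof. by move=> xy; rewrite big_setU1 ?inE //= big_set1. Qed.

(** A cut meets every cycle in an even number of edges. *)
Lemma triangle_nabla x y z W :
  adj x y -> adj y z -> adj z x ->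
  [&& [set x; y] \in nabla W, [set y; z] \in nabla W
    & [set z; x] \in nabla W] = false.
Proof.
move=> xy yz zx; rewrite !inE !edge_adj //= !card_setI_sum.
rewrite !sum_mem_pair ?adj_neq //.
by case: (x \in W); case: (y \in W); case: (z \in W).
Qed.

(** The edges of [M] partition the vertices; [W] will be a copy or the set of hubs. *)
Lemma perfect_matching_sum M W :
  perfect_matching M ->
  \sum_(e in M) \sum_(x in e) (x \in W : nat) = #|W|.
Proof.
case/and3P=> _ tM /eqP cM.
by rewrite -(big_trivIset _ tM) cM -card_setI_sum setTI.
Qed.

Lemma isomorphic_card (H : sgraph) : isomorphic G H -> #|G| = #|H|.
Proof. by case=> f /bij_eq_card. Qed.

End Graphs.

(* An edge colouring using every colour at every vertex: [act c x] is the other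
   end of the edge of colour [c] at [x]. *)
Record factorisation (C : finType) := Factorisation {
  carrier :> finType;
  act : C -> carrier -> carrier;
  actK : forall c, involutive (act c);
  act_neq : forall c x, act c x != x;
  act_inj : forall x, injective (act^~ x) }.

(** * The graph of a factorisation: regularity and class 1 *)

Section FactorisationGraph.
Variables (C : finType) (F : factorisation C).

Definition fadj : rel F := fun x y => [exists c, act c x == y].

Lemma fadjP x y : reflect (exists c, act c x = y) (fadj x y).
Proof. exact: 'exists_eqP. Qed.

Lemma fadj_sym : symmetric fadj.
Proof.
move=> x y; apply/fadjP/fadjP=> -[c <-]; exists c; exact: actK.
Qed.

Lemma fadj_irrefl : irreflexive fadj.
Proof.
by move=> x; apply/fadjP=> -[c /eqP]; rewrite (negPf (act_neq _ _)).
Qed.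

Definition graph := SGraph fadj_sym fadj_irrefl.

Lemma adj_act c (x : F) : adj (x : graph) (act c x).
Proof. by apply/fadjP; exists c. Qed.

Lemma degree_graph (x : graph) : degree x = #|C|.
Proof.
rewrite /degree -(card_codom (@act_inj _ F x)); apply: eq_card => y.
by rewrite inE; apply/fadjP/codomP=> -[c]; exists c.
Qed.

Lemma regular_graph : regular graph #|C|.
Proof. by apply/forallP=> x; rewrite degree_graph. Qed.

Definition coloured (c : C) (e : {set F}) := [exists x, e == [set x; act c x]].

Lemma coloured_edge c (e : {set F}) x :
  coloured c e -> x \in e -> e = [set x; act c x].
Proof.
by case/'exists_eqP=> y ->; rewrite !inE => /pred2P[->|->] //; rewrite actK setUC.
Qed.

Lemma edge_coloured (e : {set graph}) :
  e \in edges graph -> exists c, coloured c e.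
Proof.
case/edgeP=> x [y [/fadjP[c <-] ->]]; exists c; exact/'exists_eqP/(ex_intro _ x).
Qed.

Lemma edge_colourable_graph : edge_colourable graph #|C|.
Proof.
have ec (e : edge_type graph) : {c | coloured c (val e)}.
  exact/sigW/edge_coloured/(valP e).
apply/existsP; exists [ffun e => enum_rank (sval (ec e))].
apply/forallP=> e; apply/forallP=> f; apply/implyP=> /andP[ef].
case/pred0Pn=> x /andP[/= xe xf]; rewrite !ffunE (inj_eq enum_rank_inj).
apply: contraNneq ef => same; apply/eqP/val_inj.
rewrite (coloured_edge (svalP (ec e)) xe) (coloured_edge (svalP (ec f)) xf).
by rewrite same.
Qed.

(** The [#|C|] edges at a single vertex meet pairwise, so their colours are distinct. *)
Lemma edge_colourable_ge k : 0 < #|F| -> edge_colourable graph k -> #|C| <= k.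
Proof.
case/card_gt0P=> x _ /existsP[col /forallP colP].
pose e c : edge_type graph := Sub [set x; act c x] (edge_adj (adj_act c x)).
suff /leq_card : injective (fun c => col (e c)) by rewrite card_ord.
move=> c d same; apply: (@act_inj _ F x); apply/eqP.
have /forallP/(_ (e d))/implyP := colP (e c); rewrite same eqxx.
case: eqVneq => [/(congr1 val)/= /setP/(_ (act c x))|_].
  by rewrite !inE eqxx orbT (negPf (act_neq _ _)).
move=> h; suff: false by []; apply: h; apply/pred0Pn; exists x.
by rewrite /= !inE eqxx.
Qed.

Lemma class1_graph : 0 < #|F| -> class1 graph.
Proof.
move=> F0; have -> : class1 graph = (edge_chromatic_number graph == #|C|).
  congr (_ == _); apply/eqP; rewrite eqn_leq; apply/andP; split.
    by apply/bigmax_leqP=> x _; rewrite degree_graph.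
  have /card_gt0P[x _] := F0; rewrite -(degree_graph x).
  exact: (leq_bigmax (F := @degree graph)).
rewrite /edge_chromatic_number; case: ex_minnP => k colk mink.
by rewrite eqn_leq mink ?edge_colourable_graph ?edge_colourable_ge.
Qed.

End FactorisationGraph.

(** * Replacing vertices of K_{r,r} *)

Section Lift.
Variables (C : finZmodType) (F : factorisation C) (u : F).
Local Open Scope ring_scope.

(* The pairs (a, u) form the untouched side of K_{r,r}, and the pairs (j, x) with
   x != u the j-th copy of F - u; the edge joining a to the j-th copy has colour
   a + j. *)
Definition lift_act (c : C) (p : C * F) : C * F :=
  (if (p.2 == u) || (act c p.2 == u) then c - p.1 else p.1, act c p.2).

(** [act c] exchanges the two disjuncts of the test, so both applications take the same branch, and
    [c - (c - a) = a]. *)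
Lemma lift_actK c : involutive (lift_act c).
Proof.
case=> j x; rewrite /lift_act /= actK [(_ == u) || (x == u)]orbC.
by case: (_ || _); rewrite ?opprB 1?addrC ?subrK.
Qed.

Lemma lift_act_neq c p : lift_act c p != p.
Proof. by apply: contraNneq (act_neq c p.2) => {2}<-. Qed.

Lemma lift_act_inj p : injective (lift_act^~ p).
Proof. by move=> c d /(congr1 snd) /act_inj. Qed.

Definition lift := Factorisation lift_actK lift_act_neq lift_act_inj.

Lemma lift_act_hub a c : lift_act c (a, u) = (c - a, act c u).
Proof. by rewrite /lift_act /= eqxx. Qed.

Lemma lift_act_rim j c : lift_act c (j, act c u) = (c - j, u).
Proof. by rewrite /lift_act /= actK eqxx orbT. Qed.

Lemma lift_act_copy j c x :
  x != u -> act c x != u -> lift_act c (j, x) = (j, act c x).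
Proof. by rewrite /lift_act /= => /negPf-> /negPf->. Qed.

Definition copy (j : C) : {set graph lift} := [set p | (p.1 == j) && (p.2 != u)].

Definition copy_edges (j : C) : {set {set graph lift}} :=
  [set e in edges (graph lift) | e \subset copy j].

Definition hubs : {set graph lift} := [set p | p.2 == u].

Lemma lift_triangle x y z (j : C) :
    [&& x != u, y != u & z != u] ->
    [&& fadj x y, fadj y z & fadj z x] ->
  [&& fadj (F := lift) (j, x) (j, y), fadj (F := lift) (j, y) (j, z)
    & fadj (F := lift) (j, z) (j, x)].
Proof.
have edge v w : v != u -> w != u -> fadj v w -> fadj (F := lift) (j, v) (j, w).
  move=> vu + /fadjP[c vw]; rewrite -vw => wu.
  by apply/fadjP; exists c; apply: lift_act_copy.
by case/and3P=> xu yu zu /and3P[xy yz zx]; rewrite !edge.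
Qed.

Lemma card_copy j : #|copy j| = #|F|.-1.
Proof.
have -> : copy j = setX [set j] [set~ u].
  by apply/setP=> -[k x]; rewrite !inE.
by rewrite cardsX cards1 mul1n cardsC1.
Qed.

Lemma card_hubs : #|hubs| = #|C|.
Proof.
have -> : hubs = setX setT [set u] by apply/setP=> -[k x]; rewrite !inE.
by rewrite cardsX cards1 muln1 cardsT.
Qed.

(* Edges with an odd number of ends in some copy run from that copy to a hub. *)
Lemma lift_edge_sums e :
    e \in edges (graph lift) ->
  (forall j, \sum_(p in e) (p \in copy j : nat)
     = (e \in copy_edges j).*2 + odd (\sum_(p in e) (p \in copy j : nat)))%N
  /\ (\sum_j (odd (\sum_(p in e) (p \in copy j : nat)) : nat)
     <= \sum_(p in e) (p \in hubs : nat))%N.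
Proof.
move=> eE; have /edgeP[p [q [pq def_e]]] := eE.
have sumE W := sum_mem_pair W (adj_neq pq).
have subE j : (e \in copy_edges j) = (p \in copy j) && (q \in copy j).
  by rewrite inE eE def_e subUset !sub1set.
split=> [j|].
  by rewrite subE def_e sumE; case: (p \in _); case: (q \in _).
rewrite def_e sumE.
under eq_bigr do rewrite sumE oddD !oddb.
case/fadjP: pq => c; case: p {sumE subE def_e} => j x <-.
rewrite /= /lift_act /=.
under eq_bigr do rewrite !inE /=.
(* The edge starts at a hub, ends at a hub, or stays inside one copy; only in the first two cases
   does some copy, and then just one, contain an odd number of its ends. *)
rewrite !inE /=; case: (eqVneq x u) => [->|xu] /=.
  rewrite (negPf (act_neq _ _)).
  by under eq_bigr do rewrite andbF andbT; rewrite sum_eqb.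
case: (eqVneq (act c x) u) => [xcu|xcu] /=.
  by under eq_bigr do rewrite andbF andbT addbF; rewrite sum_eqb.
by rewrite big1 // => k _; rewrite !andbT addbb.
Qed.

Lemma card_matching_copy M j :
    ~~ odd #|F| -> perfect_matching M ->
  (#|M :&: copy_edges j|.*2.+1 = #|F|.-1)%N.
Proof.
move=> evF pM; have /and3P[/subsetP sM _ _] := pM.
(* [t j] counts the matching edges that leave copy [j]. *)
pose t j := (\sum_(e in M) odd (\sum_(p in e) (p \in copy j : nat)))%N.
have copyE k : (#|F|.-1 = #|M :&: copy_edges k|.*2 + t k)%N.
  rewrite -(card_copy k) -(perfect_matching_sum _ pM) card_setI_sum -muln2.
  rewrite big_distrl -big_split; apply: eq_bigr => e /sM /lift_edge_sums[-> _].
  by rewrite /= muln2 oddD odd_double oddb.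
have t_gt0 k : (0 < t k)%N.
  have : odd #|F|.-1.
    by move: evF; rewrite (cardD1 u) /= negbK.
  by rewrite (copyE k) oddD odd_double; case: (t k).
have sum_t : (\sum_k t k <= #|C|)%N.
  rewrite -card_hubs -(perfect_matching_sum _ pM) exchange_big.
  by apply: leq_sum => e /sM /lift_edge_sums[].
(* All [t k] are positive and their sum is at most [#|C|], so none can exceed 1. *)
have t1 : t j = 1%N.
  apply/eqP; rewrite eqn_leq t_gt0 andbT leqNgt; apply: contraL sum_t => tj.
  rewrite -ltnNge -sum1_card (bigD1 j) // [X in (_ < X)%N](bigD1 j) //=.
  by rewrite -addSn leq_add // leq_sum.
by rewrite (copyE j) t1 addn1.
Qed.

Lemma copy_edges_not_cut x y z j W :
    [&& x != u, y != u & z != u] -> [&& fadj x y, fadj y z & fadj z x] ->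
  ~ {subset copy_edges j <= nabla W}.
Proof.
move=> xyz_u xyz sub; have /and3P[xu yu zu] := xyz_u.
have /and3P[xy yz zx] := lift_triangle j xyz_u xyz.
have sub2 v w : v != u -> w != u ->
    fadj (F := lift) (j, v) (j, w) -> [set (j, v); (j, w)] \in nabla W.
  move=> vu wu vw; apply: sub; rewrite inE (edge_adj (G := graph lift)) //=.
  by rewrite subUset !sub1set !inE /= eqxx vu wu.
have := triangle_nabla (G := graph lift) W xy yz zx.
by rewrite !sub2.
Qed.

Lemma Nstar_lift x y z :
    (1 < #|C|)%N -> ~~ odd #|F| ->
    [&& x != u, y != u & z != u] -> [&& fadj x y, fadj y z & fadj z x] ->
  Nstar (graph lift) != set0.
Proof.
move=> C2 evF xyz_u xyz; have [j [k [_ _ jk]]] := card_gt1P C2.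
apply/set0Pn; exists (copy_edges j); rewrite inE; apply/and4P; split.
- by apply/subsetP=> e; rewrite inE => /andP[].
- apply/existsP=> -[M1 /existsP[M2 /and3P[pM1 pM2]]]; apply/negP; rewrite negbK.
  suff -> : #|M1 :&: copy_edges j| = #|M2 :&: copy_edges j| by [].
  by apply/double_inj/succn_inj; rewrite !card_matching_copy.
- apply/existsP=> -[W /eqP XW].
  apply: (@copy_edges_not_cut x y z j W xyz_u xyz) => e.
  by rewrite XW in_setU !in_setD in_set0 andbF andTb.
(* If the complement of [copy_edges j] were a cut, that cut would contain all edges inside another
   copy [k]. *)
- apply/existsP=> -[W /eqP/setP XW].
  apply: (@copy_edges_not_cut x y z k W xyz_u xyz) => e ek.
  have eE : e \in edges (graph lift) by move: ek; rewrite inE => /andP[].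
  have enj : e \notin copy_edges j.
    have /edgeP[p [q [_ def_e]]] := eE; move: ek; rewrite !inE eE /=.
    rewrite def_e !subUset !sub1set !inE => /andP[/andP[/eqP-> _] _].
    by rewrite eq_sym (negPf jk).
  by have := XW e; rewrite (negPf enj) in_setU !in_setD eE; case: (e \in nabla W).
Qed.

(** * Connectivity of the lift *)

Section LiftConnectivity.
Hypothesis C2 : (1 < #|C|)%N.
Hypothesis Fconn : k_connected (graph F) #|C|.
Variable S : {set graph lift}.
Hypothesis S_lt : (#|S| < #|C|)%N.

Let conn (A : {set F}) : (#|A| < #|C|)%N ->
  forall x y, x \notin A -> y \notin A -> connect (avoiding (G := graph F) A) x y.
Proof. by have /k_connectedCP[_] := Fconn; apply. Qed.

Let layer (j : C) : {set F} := [set x | (x != u) && ((j, x) \in S)].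

Let card_layer j : (#|layer j| <= #|S|)%N.
Proof.
rewrite -(card_imset _ (f := pair j)); last by move=> x y [].
by apply/subset_leq_card/subsetP=> _ /imsetP[x + ->]; rewrite inE => /andP[].
Qed.

Let step (p q : lift) : p \notin S -> q \notin S -> fadj p q ->
  connect (avoiding (G := graph lift) S) p q.
Proof. by move=> pS qS pq; apply: connect1; rewrite /avoiding /= !inE pS qS. Qed.

(** A path of [F] that avoids [u] lifts edge by edge to copy [j]. *)
Let connect_copy j x y : (#|u |: layer j| < #|C|)%N ->
  x != u -> (j, x) \notin S -> y != u -> (j, y) \notin S ->
  connect (avoiding (G := graph lift) S) (j, x) (j, y).
Proof.
move=> lt_l xu xS yu yS.
have out z : z != u -> (j, z) \notin S -> z \notin u |: layer j.
  by move=> zu zS; rewrite !inE negb_or zu.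
apply: (connect_homo (h := pair j)) (conn lt_l (out x xu xS) (out y yu yS)).
move=> {xu xS yu yS}{}x {}y /and3P[]; rewrite !inE !negb_or !negb_and.
move=> /andP[xu] /[!xu]/= xS /andP[yu] /[!yu]/= yS /fadjP[c xy].
apply: step => //; apply/fadjP; exists c; rewrite -xy in yu *.
exact: lift_act_copy.
Qed.

(** Copy [j] has [#|C|] disjoint edges to the hubs, one per colour, and [S] is too small to hit all
    of them. *)
Let connect_hub_layer j x : (#|u |: layer j| < #|C|)%N ->
  x != u -> (j, x) \notin S ->
  exists2 a, (a, u) \notin S & connect (avoiding (G := graph lift) S) (j, x) (a, u).
Proof.
move=> lt_l xu xS.
(* If [S] meets the exit of colour [c], then [blocked c] is an end of it in [S]; hence
   [blocked c \notin S] means that both ends are free. *)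
pose blocked c := if (j, act c u) \in S then (j, act c u) else (c - j, u).
have [c] : exists c, blocked c \notin S.
  have blocked_inj : injective blocked.
    move=> c d; rewrite /blocked; case: ifP => _; case: ifP => _ [].
    - exact: act_inj.
    - by move=> _ /eqP; rewrite (negPf (act_neq _ _)).
    - by move=> _ /esym/eqP; rewrite (negPf (act_neq _ _)).
    - exact: addIr.
  have /exists_notin[c cS] : (#|blocked @^-1: S| < #|C|)%N.
    apply: leq_ltn_trans S_lt; rewrite -(card_imset _ blocked_inj).
    by apply/subset_leq_card/subsetP=> _ /imsetP[c + ->]; rewrite inE.
  by exists c; rewrite inE in cS.
rewrite /blocked; case: ifP => [->//|/negbT cS aS]; exists (c - j) => //.
apply: connect_trans (connect_copy lt_l xu xS (act_neq c u) cS) _.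
by apply: step => //; apply/fadjP; exists c; apply: lift_act_rim.
Qed.

Let connect_hub_free j x : (forall a, (a, u) \notin S) ->
  (j, x) \notin S ->
  exists2 a, (a, u) \notin S & connect (avoiding (G := graph lift) S) (j, x) (a, u).
Proof.
move=> hubS xS.
have /connectP[p] : connect (avoiding (G := graph F) (layer j)) x u.
  apply: conn; first exact: leq_ltn_trans (card_layer j) S_lt.
    by rewrite inE (negPf xS) andbF.
  by rewrite inE eqxx.
elim: p x xS => [|y p IHp] x xS /=; first by move=> _ ->; exists j.
case/andP=> /and3P[_ yl /fadjP[c xy]] pP lastp.
have [->|xu] := eqVneq x u; first by exists j.
have [yu|yu] := eqVneq y u.
  exists (c - j) => //; apply: step => //; apply/fadjP; exists c.
  by rewrite -(lift_act_rim j) -yu -xy actK.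
have yS : (j, y) \notin S by move: yl; rewrite !inE yu.
have [a aS ya] := IHp y yS pP lastp; exists a => //.
apply: connect_trans ya; apply: step => //; apply/fadjP; exists c.
by rewrite -xy in yu *; apply: lift_act_copy.
Qed.

(* If S contains a hub, it misses enough of each copy for the copy to stay
   connected when u is deleted too; otherwise any path of F towards u lifts up to
   its first visit to u, where it reaches a hub. *)
Let connect_hub p : p \notin S ->
  exists2 a, (a, u) \notin S & connect (avoiding (G := graph lift) S) p (a, u).
Proof.
case: p => j x xS; case: (eqVneq x u) => [<-|xu]; first by exists j.
have [/existsP[a aS]|] := boolP [exists a, (a, u) \in S]; last first.
  by rewrite negb_exists => /forallP hubS; apply: connect_hub_free.
apply: connect_hub_layer => //; apply: leq_ltn_trans S_lt.
(* [h] embeds [u |: layer j] into [S]: the deleted hub [(a, u)] pays for [u]. *)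
pose h y := if y == u then (a, u) else (j, y).
rewrite -(card_imset _ (f := h)).
  apply/subset_leq_card/subsetP=> _ /imsetP[y + ->]; rewrite /h !inE.
  by case: eqVneq => //= _.
by move=> y z; rewrite /h; case: (eqVneq y u) => [->|_];
  case: (eqVneq z u) => [->|_] // [].
Qed.

(** Some copy [k] is untouched by [S], and every hub has a neighbour in it: hub [c] reaches it by
    colour [c + k]. *)
Let connect_hubs a b : (a, u) \notin S -> (b, u) \notin S ->
  connect (avoiding (G := graph lift) S) (a, u) (b, u).
Proof.
move=> aS bS.
have [k kS] : exists k, k \notin fst @: S.
  by apply/exists_notin/(leq_ltn_trans (leq_imset_card _ _)).
have kxS x : (k, x) \notin S by apply: contra kS => /(imset_f fst).
have lt_l : (#|u |: layer k| < #|C|)%N.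
  suff -> : layer k = set0 by rewrite setU0 cards1.
  by apply/setP=> x; rewrite !inE (negPf (kxS x)) andbF.
have link c : (c, u) \notin S ->
    connect (avoiding (G := graph lift) S) (c, u) (k, act (c + k) u).
  move=> cS; apply: step => //; apply/fadjP; exists (c + k).
  by rewrite [LHS]lift_act_hub addrAC subrr add0r.
apply: connect_trans (link a aS) _.
rewrite avoiding_sym; apply: connect_trans (link b bS) _.
by apply: connect_copy; rewrite ?act_neq.
Qed.

Lemma lift_avoiding p q : p \notin S -> q \notin S ->
  connect (avoiding (G := graph lift) S) p q.
Proof.
move=> /connect_hub[a aS pa] /connect_hub[b bS qb].
apply: connect_trans pa _; rewrite avoiding_sym; apply: connect_trans qb _.
exact: connect_hubs.
Qed.

End LiftConnectivity.

Lemma lift_connected :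
  (1 < #|C|)%N -> k_connected (graph F) #|C| -> k_connected (graph lift) #|C|.
Proof.
move=> C2 Fconn; apply/k_connectedCP; split; last exact: lift_avoiding.
have /k_connectedCP[ltF _] := Fconn.
by rewrite card_prod (leq_trans ltF) // leq_pmull // ltnW.
Qed.

End Lift.

(** * The iteration *)

Section Prism.
Variable C : finZmodType.
Local Open Scope ring_scope.

(* K_r x K_2 with the edge between (x, a) and (y, b) coloured x + y. *)
Definition prism_act (c : C) (p : C * bool) : C * bool :=
  if c - p.1 == p.1 then (p.1, ~~ p.2) else (c - p.1, p.2).

Lemma prism_actK c : involutive (prism_act c).
Proof.
case=> x b; rewrite /prism_act /=; case: (eqVneq (c - x) x) => /= [->|xc].
  by rewrite eqxx negbK.
by rewrite opprB addrC subrK eq_sym (negPf xc).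
Qed.

Lemma prism_act_neq c p : prism_act c p != p.
Proof.
case: p => x b; rewrite /prism_act /=; case: ifPn => /= [_|].
  by rewrite xpair_eqE eqxx; case: b.
by rewrite xpair_eqE => /negPf->.
Qed.

Lemma prism_act_inj p : injective (prism_act^~ p).
Proof.
case: p => x b c d; rewrite /prism_act /=.
case: eqVneq => [cx|cx]; case: eqVneq => [dx|dx].
- by move=> _; apply: (addIr (- x)); rewrite cx dx.
- by case=> /esym/eqP; rewrite (negPf dx).
- by case=> /eqP; rewrite (negPf cx).
- by case; apply: addIr.
Qed.

Definition prism := Factorisation prism_actK prism_act_neq prism_act_inj.

Lemma prism_rung x b : fadj (F := prism) (x, b) (x, ~~ b).
Proof. by apply/fadjP; exists (x + x); rewrite /= /prism_act /= addrK eqxx. Qed.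

Lemma prism_layer x y b : x != y -> fadj (F := prism) (x, b) (y, b).
Proof.
move=> xy; apply/fadjP; exists (y + x).
by rewrite /= /prism_act /= addrK eq_sym (negPf xy).
Qed.

(** Fewer than [#|C|] deletions leave some rung [k] intact, and each remaining vertex is equal or
    adjacent to the end of that rung in its own layer. *)
Lemma prism_connected : (0 < #|C|)%N -> k_connected (graph prism) #|C|.
Proof.
move=> C0; apply/k_connectedCP; split.
  by rewrite card_prod card_bool muln2 -addnn -addn1 leq_add2l.
move=> S ltS.
have step (p q : prism) : p \notin S -> q \notin S -> fadj p q ->
    connect (avoiding (G := graph prism) S) p q.
  by move=> pS qS pq; apply: connect1; rewrite /avoiding /= !inE pS qS.
have [k kS] : exists k, k \notin fst @: S.
  by apply/exists_notin/(leq_ltn_trans (leq_imset_card _ _)).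
have kbS b : (k, b) \notin S by apply: contra kS => /(imset_f fst).
have to_rung p : p \notin S -> connect (avoiding (G := graph prism) S) p (k, true).
  case: p => x b xS; apply: (@connect_trans _ _ (k, b)).
    have [->|xk] := eqVneq x k; first exact: connect0.
    by apply: step => //; apply: prism_layer.
  case: b {xS}; first exact: connect0.
  by apply: step => //; apply: prism_rung.
move=> p q /to_rung pk /to_rung; rewrite avoiding_sym; exact: connect_trans pk.
Qed.

End Prism.

(** * The sequence of iterated lifts *)

Section Tower.
Variable C : finZmodType.
Hypothesis C3 : 2 < #|C|.

(* Copies are made of the graph minus [base], so the triangle has to avoid [base]
   in order to survive. *)
Record pointed := Pointed {
  point_of : factorisation C;
  base : point_of;
  point_even : ~~ odd #|point_of|;
  point_conn : k_connected (graph point_of) #|C|;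
  point_triangle : exists x y z : point_of,
    [&& x != base, y != base & z != base] /\
    [&& fadj x y, fadj y z & fadj z x] }.

Lemma prism_triangle : exists x y z : prism C,
  [&& x != (0%R, false), y != (0%R, false) & z != (0%R, false)] /\
  [&& fadj x y, fadj y z & fadj z x].
Proof.
have [x [y [z [_ [xy yz zx]]]]] := card_gt2P C3.
(* The triangle lies in layer [true], the base point in layer [false]. *)
exists (x, true), (y, true), (z, true); rewrite !xpair_eqE !andbF /=.
by rewrite !prism_layer.
Qed.

Lemma prism_even : ~~ odd #|prism C|.
Proof. by rewrite card_prod card_bool muln2 odd_double. Qed.

Definition pointed_prism : pointed :=
  Pointed prism_even (prism_connected (ltnW (ltnW C3))) prism_triangle.

Lemma lift_even (P : pointed) : ~~ odd #|lift (base P)|.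
Proof. by rewrite card_prod oddM negb_and (point_even P) orbT. Qed.

(** The new base is a hub, so a triangle inside a copy avoids it. *)
Lemma lift_has_triangle (P : pointed) : exists x y z : lift (base P),
  [&& x != (0%R, base P), y != (0%R, base P) & z != (0%R, base P)] /\
  [&& fadj x y, fadj y z & fadj z x].
Proof.
have [x [y [z [xyz_u xyz]]]] := point_triangle P.
exists (0%R, x), (0%R, y), (0%R, z); split; last exact: lift_triangle.
by rewrite !xpair_eqE eqxx.
Qed.

Definition pointed_lift (P : pointed) : pointed :=
  Pointed (lift_even P) (lift_connected (base P) (ltnW C3) (point_conn P))
    (lift_has_triangle P).

(** At least one lift is applied, because [Nstar_lift] concerns lifts and says nothing about the
    prism itself. *)
Definition tower i : sgraph :=
  graph (point_of (iter i.+1 pointed_lift pointed_prism)).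

Lemma card_tower i : #|tower i| = #|C| ^ i.+1 * (#|C| * 2).
Proof.
elim: i => [|i IHi]; last by rewrite expnS -mulnA -IHi; apply: card_prod.
by rewrite expn1 -card_bool -!card_prod.
Qed.

Lemma tower_spec i :
  [/\ k_connected (tower i) #|C|, regular (tower i) #|C|, class1 (tower i)
    & Nstar (tower i) != set0].
Proof.
split; first exact: point_conn.
- exact: regular_graph.
- apply: class1_graph; apply/card_gt0P.
  by exists (base (iter i.+1 pointed_lift pointed_prism)).
have [x [y [z [xyz_u xyz]]]] := point_triangle (iter i pointed_lift pointed_prism).
exact: Nstar_lift (ltnW C3) (point_even _) xyz_u xyz.
Qed.

(** The order is an isomorphism invariant and grows strictly with the index. *)
Lemma tower_inj i j : isomorphic (tower i) (tower j) -> i = j.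
Proof.
move/isomorphic_card; rewrite !card_tower => /eqP.
rewrite eqn_pmul2r ?muln_gt0 ?andbT; last exact: ltnW (ltnW C3).
by rewrite eqn_exp2l ?(ltnW C3) // eqSS => /eqP.
Qed.

End Tower.

Theorem theorem1p7 (r : nat) (hr : 3 <= r) :
  exists G : nat -> sgraph,
    (forall i : nat,
       [/\ k_connected (G i) r, regular (G i) r, class1 (G i)
         & Nstar (G i) != set0]) /\
    (forall i j : nat, isomorphic (G i) (G j) -> i = j).
Proof.
(* The colours are the integers modulo [r.+1]; the successor form gives the ordinals their group
   structure. *)
case: r hr => // r hr; have C3 : 2 < #|'I_r.+1| by rewrite card_ord.
exists (tower C3); split=> [i|]; last exact: tower_inj.
by have := tower_spec C3 i; rewrite card_ord.
Qed.
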